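(* For every fixed $p\in(0,1)$, the random graph $G(n,p)$ is almost surely not prime; that is, $\Pr[\,G(n,p)\text{ is a prime graph}\,]\to 0$ as $n\to\infty$.
   Context: All graphs are finite and simple. A coprime labeling of a graph $G$ is an injection $f\colon V(G)\to\{1,2,\dots,k\}$, for some integer $k\ge |V(G)|$, such that $\gcd(f(u),f(v))=1$ whenever $(u,v)\in E(G)$. The minimum coprime number $\mathfrak{pr}(G)$ is the least $k$ for which such a labeling exists. $G$ is a prime graph if $\mathfrak{pr}(G)=|V(G)|$. $G(n,p)$ is the Erdős–Rényi random graph: the random spanning subgraph of the complete graph $K_n$ in which each edge appears independently with probability $p$. ''Almost surely'' means with probability tending to $1$ as $n\to\infty$. *)

(* Defs.v *)
From HB Require Import structures.
From mathcomp Require Import all_boot all_order all_algebra.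
From mathcomp Require Import all_classical all_reals all_analysis.

Set Implicit Arguments.
Unset Strict Implicit.
Unset Printing Implicit Defensive.

Import Order.TTheory GRing.Theory Num.Theory.
Import numFieldNormedType.Exports.

Local Open Scope ring_scope.

Section SimpleGraph.
Variable V : finType.

(* A simple graph on V is its set of edges, each a two-element set. *)
Definition vpairs : {set {set V}} := finset (fun e : {set V} => #|e| == 2).

Record sgraph := SGraph { edges : {set {set V}}; _ : edges \subset vpairs }.

HB.instance Definition _ := [isSub for edges].
HB.instance Definition _ := [Finite of sgraph by <:].

Lemma edgesP (G : sgraph) : edges G \subset vpairs.
Proof. by case: G. Qed.

Definition adj (G : sgraph) : rel V := fun u v => [set u; v]%SET \in edges G.

Definition coprime_labeling (G : sgraph) (k : nat) (f : V -> nat) : Prop :=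
  [/\ injective f,
      forall v, (1 <= f v <= k)%N
    & forall u v, adj G u v -> coprime (f u) (f v)].

Definition has_coprime_labeling (G : sgraph) (k : nat) : Prop :=
  (#|V| <= k)%N /\ exists f : V -> nat, coprime_labeling G k f.

Lemma ex_coprime_labeling (G : sgraph) :
  exists k, `[< has_coprime_labeling G k >].
Proof.
pose f (v : V) := (2 ^ 2 ^ enum_rank v).+1.
have f_inj : injective f.
  move=> u v [] /eqP; rewrite eqn_exp2l // eqn_exp2l // => /eqP.
  by move=> /val_inj/enum_rank_inj.
pose k := (#|V| + \max_v f v)%N.
exists k; apply/asboolP; split; first exact: leq_addr.
exists f; split=> // [v|u v].
  rewrite /= (leq_trans (leq_bigmax v)) ?leq_addl //.
suff cop m n : (m < n)%N -> coprime (2 ^ 2 ^ m).+1 (2 ^ 2 ^ n).+1.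
  have [->|ne_uv] := eqVneq u v.
    move=> uv; have := fintype.subsetP (edgesP G) _ uv.
    by rewrite inE finset.setUid cards1.
  have : (enum_rank u : nat) != enum_rank v.
    by apply: contra_neq ne_uv => /val_inj/enum_rank_inj.
  by rewrite neq_ltn => /orP[] /cop //; rewrite coprime_sym.
move=> ltmn.
have /dvdnP[q eq_q] : ((2 ^ 2 ^ m).+1 %| (2 ^ 2 ^ n).-1)%N.
  have -> : (2 ^ 2 ^ n = (2 ^ 2 ^ m.+1) ^ (2 ^ (n - m.+1)))%N.
    by rewrite -expnM -expnD subnKC.
  apply: (@dvdn_trans (2 ^ 2 ^ m.+1).-1); last exact: dvdn_pred_predX.
  rewrite expnS mulnC expnM -!subn1 -[X in (_ - X)%N](exp1n 2) subn_sqr.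
  by rewrite addn1 dvdn_mull.
have -> : ((2 ^ 2 ^ n).+1 = q * (2 ^ 2 ^ m).+1 + 2)%N.
  by rewrite -eq_q addn2 prednK ?expn_gt0.
by rewrite /coprime gcdnMDl -/(coprime _ _) coprimen2 /= oddX orbF expn_eq0.
Qed.

Definition min_coprime_number (G : sgraph) : nat :=
  ex_minn (ex_coprime_labeling G).

Definition prime_graph (G : sgraph) : bool := min_coprime_number G == #|V|.

End SimpleGraph.

Section RandomGraph.
Variables (R : realType) (n : nat) (p : R).

Definition gnp_mass (G : sgraph 'I_n) : R :=
  \prod_(e in vpairs 'I_n) (if e \in edges G then p else 1 - p).

Definition gnp_prob (A : pred (sgraph 'I_n)) : R :=
  \sum_(G : sgraph 'I_n | A G) gnp_mass G.

(* gnp_mass is the law of independent edges of probability p: the probability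
   of any pattern of prescribed present (S) and absent (T) edges factors, and
   S = T = set0 gives total mass 1. *)
Lemma gnp_prob_edges (S T : {set {set 'I_n}}) :
  S \subset vpairs 'I_n -> T \subset vpairs 'I_n -> [disjoint S & T] ->
  gnp_prob (fun G => (S \subset edges G) && [disjoint T & edges G])
  = p ^+ #|S| * (1 - p) ^+ #|T|.
Proof.
move=> sSP sTP dST; set P := vpairs 'I_n in sSP sTP *.
pose F e : R := if e \in P then (if e \in T then 0 else p) else 0.
pose H e : R := if e \in P then (if e \in S then 0 else 1 - p) else 1.
transitivity (\sum_(E : {set {set 'I_n}})
    \prod_e (if e \in E then F e else H e)); last first.
  rewrite -bigA_distr /= (bigID (mem (S :|: T)%SET)) /= [X in _ * X]big1 => [|e].
    rewrite mulr1 (eq_bigl [predU S & T]) => [|e]; last by rewrite !inE.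
    rewrite bigU //=; congr (_ * _).
      rewrite -prodr_const; apply: eq_bigr => e eS.
      by rewrite /F /H (fintype.subsetP sSP) // eS (disjointFr dST eS) addr0.
    rewrite -prodr_const; apply: eq_bigr => e eT.
    by rewrite /F /H (fintype.subsetP sTP) // eT (disjointFl dST eT) add0r.
  rewrite !inE negb_or => /andP[/negPf eS /negPf eT].
  by rewrite /F /H eS eT; case: ifP; rewrite ?add0r // addrC subrK.
pose Q (E : {set {set 'I_n}}) :=
  [&& E \subset P, S \subset E & [disjoint T & E]].
rewrite (bigID Q) /= [X in _ + X]big1 => [|E nQ]; last first.
  case/nandP: nQ => [/fintype.subsetPn[e eE eP]|/nandP[/fintype.subsetPn[e eS eE]|]].
  - by rewrite (bigD1 e) //= eE /F (negPf eP) mul0r.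
  - by rewrite (bigD1 e) //= (negPf eE) /H (fintype.subsetP sSP) // eS mul0r.
  - case/pred0Pn=> e /andP[/= eT eE].
    by rewrite (bigD1 e) //= eE /F (fintype.subsetP sTP) // eT mul0r.
rewrite addr0 /gnp_prob [RHS](reindex_omap (@edges _) insub) /= => [|E /andP[EP _]];
  last by rewrite insubT.
apply: eq_big => [G|G /andP[SG dTG]].
  by rewrite /Q valK eqxx andbT edgesP.
rewrite (bigID (mem P)) /= [X in _ * X]big1 => [|e eP]; last first.
  by rewrite (contraNF (fintype.subsetP (edgesP G) e)) ?/H (negPf eP).
rewrite mulr1; apply: eq_bigr => e eP; rewrite /F /H eP.
case: ifPn => eG; first by rewrite (disjointFl dTG eG).
by rewrite (contraNF (fintype.subsetP SG e) eG).
Qed.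

End RandomGraph.

(* Main.v *)
Require Import Defs.
From HB Require Import structures.
From mathcomp Require Import all_boot all_order all_algebra.
From mathcomp Require Import all_classical all_reals all_analysis.
From mathcomp Require Import zify.

(** A prime labeling of a graph with [n] vertices uses each of the labels
    1, ..., n exactly once, and two vertices with even labels are never
    adjacent: a prime graph has an independent set of size [n./2]
    ([prime_graph_indep]).  Random graphs of constant density have only much
    smaller ones, by the first moment method: there are at most [2 ^ n]
    vertex sets of size [n./2], and each is independent with probability
    [(1 - p) ^+ 'C(n./2, 2)] ([gnp_prob_indep]), so the union bound gives
      [Pr(G(n,p) is prime) <= 2 ^+ n * (1 - p) ^+ 'C(n./2, 2)]
    ([gnp_prob_prime_le]).  As the second exponent is quadratic in [n], it
    is eventually at least [N * n] for any constant [N]; choosing [N] with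
    [(1 - p) ^+ N < 1 / 4] bounds the probability by [(1 / 2) ^+ n]. *)

Import Order.TTheory GRing.Theory Num.Theory.
Import numFieldNormedType.Exports.

Local Open Scope ring_scope.

Definition pairs_in {V : finType} (U : {set V}) : {set {set V}} :=
  finset (fun e : {set V} => (e \subset U) && (#|e| == 2)).

(** Phrased as the absence of a fixed set of edges, an event whose probability
    [gnp_prob_edges] computes. *)
Definition independent {V : finType} (G : sgraph V) (U : {set V}) : bool :=
  [disjoint pairs_in U & edges G].

Lemma prime_graphP {V : finType} (G : sgraph V) :
  prime_graph G -> exists f : V -> nat, coprime_labeling G #|V| f.
Proof.
rewrite /prime_graph /min_coprime_number.
by case: ex_minnP => k /asboolP[_ fP] _ /eqP <-.
Qed.

(** The injection into [{1, ..., #|V|}] is onto by counting, so each even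
    label [2 * i + 2] with [i < #|V|./2] is carried by some vertex; these
    vertices form the independent set. *)
Lemma prime_graph_indep {V : finType} (G : sgraph V) :
  prime_graph G -> exists U : {set V}, (#|U| == #|V|./2) && independent G U.
Proof.
case/prime_graphP => f [f_inj f_bnd f_cop].
have g_lt v : ((f v).-1 < #|V|)%N by have := f_bnd v; lia.
pose g v : 'I_#|V| := Ordinal (g_lt v).
have g_inj : injective g.
  move=> u v /(congr1 val) /= guv; apply: f_inj.
  by have := f_bnd u; have := f_bnd v; lia.
have [h _ gK] : bijective g by apply: inj_card_bij; rewrite ?card_ord.
have d_lt (i : 'I_(#|V|./2)) : (i.*2.+1 < #|V|)%N by have := ltn_ord i; lia.
pose w i := h (Ordinal (d_lt i)).
have fw i : f (w i) = (i.+1).*2.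
  have /(congr1 val) /= pred_fw := gK (Ordinal (d_lt i)).
  by have /andP[/prednK <- _] := f_bnd (w i); rewrite pred_fw.
have w_inj : injective w.
  by move=> i j /(congr1 f); rewrite !fw => /double_inj[] /val_inj.
exists (w @: [set: 'I_(#|V|./2)])%SET.
rewrite card_imset //= cardsT card_ord eqxx andTb.
rewrite /independent disjoint_subset; apply/fintype.subsetP => e.
rewrite !finset.inE => /andP[eU /cards2P[u [v [_ def_e]]]].
apply/negP => eG.
move: eU eG; rewrite def_e => /fintype.subsetP eU eG.
have /imsetP[i _ def_u] := eU u (set21 u v).
have /imsetP[j _ def_v] := eU v (set22 u v).
(* Both labels are even, so 2 divides their gcd. *)
have := f_cop u v eG; rewrite def_u def_v !fw -!muln2 /coprime.
by rewrite -muln_gcdl; lia.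
Qed.

Lemma card_pairs_in {V : finType} (U : {set V}) : #|pairs_in U| = 'C(#|U|, 2).
Proof. by rewrite -cards_draws. Qed.

Section RandomGraph.
Context {R : realType} {p : R}.
Hypothesis hp : 0 < p < 1.

Lemma gnp_mass_ge0 n (G : sgraph 'I_n) : 0 <= gnp_mass p G.
Proof.
case/andP: hp => p0 p1; apply: prodr_ge0 => e _.
by case: ifP => _; rewrite ?subr_ge0 ltW.
Qed.

Lemma gnp_prob_indep n (U : {set 'I_n}) :
  gnp_prob p (fun G => independent G U) = (1 - p) ^+ 'C(#|U|, 2).
Proof.
have sub_pairs : pairs_in U \subset vpairs 'I_n.
  by apply/fintype.subsetP => e; rewrite !finset.inE => /andP[].
have disj0 : [disjoint (@finset.set0 {set 'I_n}) & pairs_in U].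
  by rewrite -finset.setI_eq0 finset.set0I.
have := gnp_prob_edges p (finset.sub0set _) sub_pairs disj0.
rewrite cards0 expr0 mul1r card_pairs_in => <-.
by apply: eq_bigl => G; rewrite finset.sub0set.
Qed.

(** Markov's inequality in disguise: summed over [i], the masses of the
    [B i] count each graph of [A] at least once. *)
Lemma gnp_prob_union n (I : finType) (J : pred I) (A : pred (sgraph 'I_n))
    (B : I -> pred (sgraph 'I_n)) :
  (forall G, A G -> exists i, J i && B i G) ->
  gnp_prob p A <= \sum_(i | J i) gnp_prob p (B i).
Proof.
move=> AB; rewrite (exchange_big_dep predT) //= /gnp_prob big_mkcond /=.
apply: ler_sum => G _; case: ifP => [/AB[i iP]|_]; last first.
  by apply: sumr_ge0 => i _; exact: gnp_mass_ge0.
rewrite (bigD1 i) //= lerDl; apply: sumr_ge0 => j _; exact: gnp_mass_ge0.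
Qed.

Lemma gnp_prob_prime_le n :
  gnp_prob p (@prime_graph 'I_n) <= 2 ^+ n * (1 - p) ^+ 'C(n./2, 2).
Proof.
apply: (@le_trans _ _ (\sum_(U : {set 'I_n} | #|U| == n./2)
    gnp_prob p (fun G => independent G U))).
  by apply: gnp_prob_union => G /prime_graph_indep; rewrite card_ord.
rewrite (eq_bigr (fun=> (1 - p) ^+ 'C(n./2, 2))) => [|U /eqP <-]; last first.
  exact: gnp_prob_indep.
rewrite sumr_const -[leLHS]mulr_natl -natrX ler_wpM2r //.
  by rewrite exprn_ge0 // subr_ge0 ltW //; case/andP: hp.
(* Forgetting the size constraint leaves all the subsets of 'I_n. *)
rewrite ler_nat -[X in (_ <= 2 ^ X)%N]card_ord -cardsT -card_powerset powersetT.
by rewrite cardsT max_card.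
Qed.

End RandomGraph.

(** The left side is linear and the right side is about [n ^ 2 / 8], so any
    threshold well above [8 * N] works. *)
Lemma leq_mul_bin_half N n : (16 * N + 4 <= n)%N -> (N * n <= 'C(n./2, 2))%N.
Proof.
move=> le_n; rewrite bin2; set m := n./2.
have le_m : (8 * N + 2 <= m)%N by rewrite /m; lia.
have le_nm : (n <= 2 * m + 1)%N by rewrite /m; lia.
rewrite -(doubleK (N * n)%N) half_leq //.
have : (m * (8 * N) <= m * m.-1)%N by rewrite leq_mul2l; lia.
by apply: leq_trans; nia.
Qed.

Local Open Scope classical_set_scope.

Theorem corollary1p1 (R : realType) (p : R) (hp : 0 < p < 1) :
  (fun n : nat => gnp_prob p (@prime_graph 'I_n)) @ \oo --> (0 : R).
Proof.
have q01 : 0 <= 1 - p <= 1.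
  by case/andP: hp => p0 p1; rewrite subr_ge0 gerBl !ltW.
(* Below 1 / 4, the N-th power beats the factor 2 contributed by each vertex
   to the number of vertex sets, leaving a ratio of 1 / 2. *)
have [N qN] : exists N, (1 - p) ^+ N < 4^-1.
  have /cvgrPdist_lt /(_ 4^-1) : (fun n => (1 - p) ^+ n) @ \oo --> (0 : R).
    apply: cvg_expr; case/andP: hp q01 => p0 _ /andP[q0 _].
    by rewrite ger0_norm ?gtrBl.
  rewrite invr_gt0 ltr0n => /(_ isT)[N _ /(_ N (leqnn N))] /=.
  by rewrite sub0r normrN ger0_norm ?exprn_ge0 //; [exists N | case/andP: q01].
have half_cvg : (fun n => 2^-1 ^+ n) @ \oo --> (0 : R).
  by apply: cvg_expr; rewrite ger0_norm ?invr_ge0 // invf_lt1 // ltr1n.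
apply: (squeeze_cvgr _ (@cvg_cst _ _ _ _ _) half_cvg).
near=> n; apply/andP; split.
  by apply: sumr_ge0 => G _; exact: gnp_mass_ge0.
apply: (le_trans (gnp_prob_prime_le hp n)).
have /andP[q0 q1] := q01.
have le_q : (1 - p) ^+ 'C(n./2, 2) <= 4^-1 ^+ n.
  apply: (@le_trans _ _ ((1 - p) ^+ (N * n))).
    apply: ler_wiXn2l => //; apply: leq_mul_bin_half.
    by near: n; exact: nbhs_infty_ge.
  by rewrite exprM lerXn2r ?nnegrE ?exprn_ge0 ?invr_ge0 // ltW.
have -> : (2^-1 : R) = 2 * 4^-1 by rewrite (natrM _ 2 2) invfM mulVKf.
by rewrite exprMn ler_wpM2l ?exprn_ge0.
Unshelve. all: by end_near.
Qed.
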